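(* Let $\Sigma_f=\tilde\Sigma^*$, where $(\tilde\Sigma^*,Z^* )$ is the optimal solution of the semidefinite program $$\min_{\tilde\Sigma,Z}\ \mathrm{tr}(\tilde\Sigma)\quad\text{s.t.}\quad\begin{bmatrix}\tilde\Sigma-D^\ell D^{\ell\top}&A^\ell\tilde\Sigma+B^\ell Z\\ \tilde\Sigma A^{\ell\top}+Z^\top B^{\ell\top}&\tilde\Sigma\end{bmatrix}\succeq0,\quad \ell=1,\dots,N_p,$$ over $\tilde\Sigma\in\mathbb{R}^{n_x\times n_x}$, $Z\in\mathbb{R}^{n_u\times n_x}$, and let $\tilde L^*=Z^*(\tilde\Sigma^* )^{-1}$. Let $\mathcal{X}_f^\mu$ be the largest set such that $\mathcal{X}_f^\mu\subseteq\mathcal{X}_{\mathrm{safe}}$ and $$\mu\in\mathcal{X}_f^\mu\implies\exists\,v\in\mathcal{U}_{\mathrm{safe}}:\ A^\ell\mu+B^\ell v+r^\ell\in\mathcal{X}_f^\mu\ \text{ for all }\ell=1,\dots,N_p,$$ where $$\mathcal{X}_{\mathrm{safe}}=\bigcap_{i=1}^{N_x}\{\mu:\alpha_{x,i}^\top\mu\le\tilde\beta_{x,i}\},\qquad \mathcal{U}_{\mathrm{safe}}=\bigcap_{j=1}^{N_u}\{v:\alpha_{u,j}^\top v\le\tilde\beta_{u,j}\},$$ $$\tilde\beta_{x,i}=\beta_{x,i}-\sqrt{\alpha_{x,i}^\top\Sigma_f\alpha_{x,i}}\;\Phi^{-1}(1-p_{x,i}),\qquad \tilde\beta_{u,j}=\beta_{u,j}-\sqrt{\alpha_{u,j}^\top\tilde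 L^*\Sigma_f\tilde L^{*\top}\alpha_{u,j}}\;\Phi^{-1}(1-p_{u,j}).$$ Then, given any $\mu\in\mathcal{X}_f^\mu$ and any covariance matrix $\Sigma\preceq\Sigma_f$, there exists a policy $\rho(\cdot)$ such that, for all $A\in\mathcal{A}$, $B\in\mathcal{B}$, $D\in\mathcal{D}$, $r\in\mathcal{R}$ (with $[A\ B\ D\ r]\in\mathcal{S}$), $$\Pr(\alpha_{x,i}^\top x\le\beta_{x,i})\ge1-p_{x,i},\ i=1,\dots,N_x,\qquad \Pr(\alpha_{u,j}^\top u\le\beta_{u,j})\ge1-p_{u,j},\ j=1,\dots,N_u,$$ $$A\mu+B\bar u+r\in\mathcal{X}_f^\mu,\qquad A\Sigma A^\top+A\Sigma_{xu}B^\top+B\Sigma_{xu}^\top A^\top+B\Sigma_uB^\top+DD^\top\preceq\Sigma_f,$$ where $x\sim\mathcal{N}(\mu,\Sigma)$, $u=\rho(x)$, $\bar u=\mathbb{E}[u\mid\mu,\Sigma]$, $\Sigma_{xu}=\mathbb{E}[(x-\mu)(u-\bar u)^\top\mid\mu,\Sigma]$ and $\Sigma_u=\mathbb{E}[(u-\bar u)(u-\bar u)^\top\mid\mu,\Sigma]$.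
   Context: The matrices $A^\ell\in\mathbb{R}^{n_x\times n_x}$, $B^\ell\in\mathbb{R}^{n_x\times n_u}$, $D^\ell\in\mathbb{R}^{n_x\times n_w}$ and vectors $r^\ell\in\mathbb{R}^{n_x}$, $\ell=1,\dots,N_p$, are given; $S^\ell=[A^\ell\ B^\ell\ D^\ell\ r^\ell]$ and $\mathcal{S}=\mathrm{co}\{S^1,\dots,S^{N_p}\}$ (convex hull). $\mathcal{A},\mathcal{B},\mathcal{D},\mathcal{R}$ are the sets of admissible values of $A,B,D,r$, the admissible quadruples satisfying $[A\ B\ D\ r]\in\mathcal{S}$. $\alpha_{x,i}\in\mathbb{R}^{n_x}$, $\alpha_{u,j}\in\mathbb{R}^{n_u}$, $\beta_{x,i},\beta_{u,j}\in\mathbb{R}$, and probabilities $p_{x,i},p_{u,j}$ are given ($i=1,\dots,N_x$, $j=1,\dots,N_u$). $\Phi^{-1}$ is the inverse of the standard normal cumulative distribution function. An optimal solution of the semidefinite program is taken to exist with $\tilde\Sigma^*$ symmetric and $\tilde\Sigma^*\succ0$, so that $\tilde L^*$ is defined. A policy is a function $\rho:\mathbb{R}^{n_x}\to\mathbb{R}^{n_u}$ (which may depend on $\mu,\Sigma$) such that for $w\sim\mathcal{N}(0,I)$ independent of $x$, the next state $Ax+B\rho(x)+Dw+r$ is Gaussian.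
   Formalization: All probabilities p_{x,i} and p_{u,j} are assumed to satisfy 0 < p ≤ 1/2: Φ^{-1}(1-p) must be a real number, and for p > 1/2 the claim can fail (e.g. A=B=0, D=1, r=0, α_x=1, β_x=0, p_x=0.9, μ=1, Σ=0). *)

(* Defs.v *)
From HB Require Import structures.
From mathcomp Require Import all_boot all_order all_algebra.
From mathcomp Require Import all_classical all_reals all_analysis.
Import Order.TTheory GRing.Theory Num.Theory.
Import numFieldNormedType.Exports.

Set Implicit Arguments.
Unset Strict Implicit.
Unset Printing Implicit Defensive.

Local Open Scope classical_set_scope.
Local Open Scope ring_scope.

Section Matrices.
Context {R : realType}.

Definition dot n (a x : 'cV[R]_n) : R := (a^T *m x) 0 0.

Definition quad n (S : 'M[R]_n) (a : 'cV[R]_n) : R := (a^T *m S *m a) 0 0.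

(* Semidefiniteness and definiteness both include symmetry. *)
Definition psd n (S : 'M[R]_n) : Prop :=
  S^T = S /\ forall a : 'cV[R]_n, 0 <= quad S a.

Definition posdef n (S : 'M[R]_n) : Prop :=
  S^T = S /\ forall a : 'cV[R]_n, a != 0 -> 0 < quad S a.

Definition loewner_le n (S T : 'M[R]_n) : Prop := psd (T - S).

Definition conv_hull m n N (S : 'I_N -> 'M[R]_(m, n)) : set 'M[R]_(m, n) :=
  [set M | exists lam : 'I_N -> R,
     [/\ forall l, 0 <= lam l,
         \sum_l lam l = 1 &
         M = \sum_l lam l *: S l]].

Definition polyhedron n N (a : 'I_N -> 'cV[R]_n) (b : 'I_N -> R) :
    set 'cV[R]_n :=
  \bigcap_(i in [set: 'I_N]) [set x | dot (a i) x <= b i].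

Definition is_largest U (Q : set U -> Prop) (X : set U) : Prop :=
  Q X /\ forall Y, Q Y -> Y `<=` X.

End Matrices.

Section Gaussian.
Context {R : realType}.

Definition Phi (z : R) : R := fine (normal_prob 0 1 `]-oo, z]).

(* Only meaningful for q in ]0, 1[, where the preimage is a singleton. *)
Definition Phi_inv (q : R) : R := get [set z | Phi z = q].

(* The univariate normal law with mean m and variance v. The parameter of
   normal_prob is the standard deviation, and normal_prob m 0 is the uniform
   law on [0, 1] instead of the Dirac mass at m. *)
Definition gauss (m v : R) : set R -> \bar R :=
  if v == 0 then \d_m else normal_prob m (Num.sqrt v).

(* The Borel sigma-algebra of R^n, generated by the coordinates as in the
   library's sigma-algebra on n.-tuple R. *)
Definition borel n : set (set 'cV[R]_n) :=
  g_sigma_preimage (fun (i : 'I_n) (x : 'cV[R]_n) => x i 0).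

Definition borel_fun n m (f : 'cV[R]_n -> 'cV[R]_m) : Prop :=
  forall C, borel C -> borel (f @^-1` C).

Section RandomVectors.
Context {d : measure_display} {T : measurableType d} (P : probability T R).

Definition random_vector n (x : T -> 'cV[R]_n) : Prop :=
  forall i, measurable_fun setT (fun t => x t i 0).

(* x ~ N(mu, S), where S may be singular: every linear form of x is univariate
   normal, with the corresponding mean and variance. *)
Definition normal_vector n (x : T -> 'cV[R]_n) (mu : 'cV[R]_n) (S : 'M[R]_n) :
    Prop :=
  [/\ psd S, random_vector x &
      forall (a : 'cV[R]_n) (C : set R), measurable C ->
        P [set t | C (dot a (x t))] = gauss (dot a mu) (quad S a) C].

Definition is_gaussian n (x : T -> 'cV[R]_n) : Prop :=
  exists mu S, normal_vector x mu S.

Definition independent n m (x : T -> 'cV[R]_n) (y : T -> 'cV[R]_m) : Prop :=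
  forall C E, borel C -> borel E ->
    P (x @^-1` C `&` y @^-1` E) = (P (x @^-1` C) * P (y @^-1` E))%E.

(* Entrywise expectation; an entry with infinite expectation is sent to 0, so
   integrability has to be stated separately. *)
Definition expect_mx m n (M : T -> 'M[R]_(m, n)) : 'M[R]_(m, n) :=
  \matrix_(i, j) fine ('E_P[fun t => M t i j])%E.

Definition square_integrable n (x : T -> 'cV[R]_n) : Prop :=
  forall i, (fun t => x t i 0) \in Lfun P 2%:E.

End RandomVectors.
End Gaussian.

Section Control.
Context {R : realType} {nx nu nw Np : nat}.
Variables (A : 'I_Np -> 'M[R]_nx) (B : 'I_Np -> 'M[R]_(nx, nu)).
Variables (D : 'I_Np -> 'M[R]_(nx, nw)) (r : 'I_Np -> 'cV[R]_nx).

Definition sys_mx (A : 'M[R]_nx) (B : 'M[R]_(nx, nu)) (D : 'M[R]_(nx, nw))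
    (r : 'cV[R]_nx) : 'M[R]_(nx, nx + (nu + (nw + 1))) :=
  row_mx A (row_mx B (row_mx D r)).

Definition admissible (A0 : 'M[R]_nx) (B0 : 'M[R]_(nx, nu))
    (D0 : 'M[R]_(nx, nw)) (r0 : 'cV[R]_nx) : Prop :=
  conv_hull (fun l => sys_mx (A l) (B l) (D l) (r l)) (sys_mx A0 B0 D0 r0).

Definition sdp_feasible (S : 'M[R]_nx) (Z : 'M[R]_(nu, nx)) : Prop :=
  forall l, psd (block_mx
    (S - D l *m (D l)^T)              (A l *m S + B l *m Z)
    (S *m (A l)^T + Z^T *m (B l)^T)   S).

Definition sdp_optimal (S : 'M[R]_nx) (Z : 'M[R]_(nu, nx)) : Prop :=
  sdp_feasible S Z /\ forall S' Z', sdp_feasible S' Z' -> \tr S <= \tr S'.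

Definition safe_invariant (Xsafe : set 'cV[R]_nx) (Usafe : set 'cV[R]_nu)
    (X : set 'cV[R]_nx) : Prop :=
  X `<=` Xsafe /\
  forall mu, X mu -> exists2 v, Usafe v &
    forall l, X (A l *m mu + B l *m v + r l).

(* A single rho has to work for every admissible system, since the true system
   is unknown to the controller. *)
Definition is_policy (mu : 'cV[R]_nx) (S : 'M[R]_nx)
    (rho : 'cV[R]_nx -> 'cV[R]_nu) : Prop :=
  borel_fun rho /\
  forall A0 B0 D0 r0, admissible A0 B0 D0 r0 ->
  forall (d : measure_display) (T : measurableType d) (P : probability T R)
    (x : T -> 'cV[R]_nx) (w : T -> 'cV[R]_nw),
  normal_vector P x mu S -> normal_vector P w 0 1%:M -> independent P x w ->
  is_gaussian P (fun t => A0 *m x t + B0 *m rho (x t) + D0 *m w t + r0).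

End Control.

(* The bounds beta_i - sqrt(a_i^T S a_i) Phi^-1(1 - p_i). *)
Definition tighten {R : realType} n N (a : 'I_N -> 'cV[R]_n) (b p : 'I_N -> R)
    (S : 'M[R]_n) (i : 'I_N) : R :=
  b i - Num.sqrt (quad S (a i)) * Phi_inv (1 - p i).

(* Main.v *)
Require Import Defs.
From HB Require Import structures.
From mathcomp Require Import all_boot all_order all_algebra.
From mathcomp Require Import all_classical all_reals all_analysis.
From mathcomp Require Import measurable_realfun ring lra.
Import Order.TTheory GRing.Theory Num.Theory.
Import numFieldNormedType.Exports.

(** The policy is the affine feedback [rho x = v + L (x - mu)], where
    [L = Z Sf^-1] and [v] is the input given by the invariance of [Xf] at [mu].

    Evaluating the block matrix of the semidefinite program at [(a, - G^T a)]
    with [G = A l + B l L] gives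
    [Sf(G^T a) + |(D l)^T a|^2 <= Sf(a)] at each vertex [l], where [Sf(.)] is
    the quadratic form of [Sf]; the left-hand side is convex in [(G, D l)], so
    the bound holds for all admissible systems, which is the covariance bound.
    Since the set of convex combinations of points of [Xf] is again a safe
    invariant set, [Xf] is convex by maximality, and the mean of the next state
    is a convex combination of points of [Xf]. Every linear form of the state
    and of the input is normal with variance at most the one used in the
    tightened bounds, and [Phi^-1 (1 - p) >= 0] because [p <= 1/2], which gives
    the chance constraints. The next state is Gaussian because the convolution
    of two univariate normal laws is normal. *)

Set Implicit Arguments.
Unset Strict Implicit.
Unset Printing Implicit Defensive.

Local Open Scope classical_set_scope.
Local Open Scope ring_scope.

(** * Normal laws on the real line *)

Definition image_measure d d' (T : measurableType d) (T' : measurableType d')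
    (R : realType) (m : {measure set T -> \bar R}) (f : T -> T')
    (mf : measurable_fun setT f) : {measure set T' -> \bar R}.
Proof. by refine (pushforward m f). Defined.

(** * Affine change of variables for Lebesgue measure *)

Section Lebesgue.
Context {R : realType}.
Notation leb := (@lebesgue_measure R).

Lemma measurable_affine (s m : R) : measurable_fun setT (fun x : R => s * x + m).
Proof. by apply: measurable_funD => //; exact: measurable_funM. Qed.

Lemma preimage_affine_itvoc (s m a b : R) : s != 0 ->
  (fun x : R => s * x + m) @^-1` `]a, b] =
  if 0 < s then `](a - m) / s, (b - m) / s]%classic
  else `[(b - m) / s, (a - m) / s[%classic.
Proof.
move=> s0; case: ifPn => sgn; apply/seteqP; split => x /=; rewrite !in_itv/=.
- by rewrite ltr_pdivrMr// ler_pdivlMr// (mulrC x) ltrBlDr lerBrDr.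
- by rewrite ltr_pdivrMr// ler_pdivlMr// (mulrC x) ltrBlDr lerBrDr.
- have sN : s < 0 by rewrite lt_neqAle s0 leNgt.
  by rewrite ler_ndivrMr// ltr_ndivlMr// (mulrC x) ltrBlDr lerBrDr andbC.
- have sN : s < 0 by rewrite lt_neqAle s0 leNgt.
  by rewrite ler_ndivrMr// ltr_ndivlMr// (mulrC x) ltrBlDr lerBrDr andbC.
Qed.

(** Lebesgue measure is the only measure that gives each interval []a, b]] its length. Scaling the
    image measure by [|s|] yields such a measure, since preimages of intervals shrink by that
    factor. *)
Lemma lebesgue_measure_affine (s m : R) (C : set R) : s != 0 -> measurable C ->
  (`|s|%:E * leb ((fun x => s * x + m)%R @^-1` C) = leb C)%E.
Proof.
move=> s0 mC.
pose f := (fun x => s * x + m)%R : measurableTypeR R -> measurableTypeR R.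
have mf : measurable_fun setT f.
  exact: measurable_affine.
pose p : {measure set (measurableTypeR R) -> \bar R} :=
  mscale (NngNum (normr_ge0 s)) (image_measure leb mf).
rewrite [RHS](@lebesgue_measure_unique _ p)// => X [[a b] /= _ <-].
rewrite /p /mscale/= /pushforward preimage_affine_itvoc//.
(* For [b <= a] the interval and its preimage are both empty. *)
have [ab|ba] := ltP a b; last first.
  rewrite set_itv_ge ?bnd_simp -?leNgt// measure0.
  case: ifPn => sgn.
    rewrite set_itv_ge ?measure0 ?mule0// bnd_simp -leNgt.
    by rewrite ler_pM2r ?invr_gt0// lerB.
  rewrite set_itv_ge ?measure0 ?mule0// bnd_simp -leNgt.
  have sN : s < 0 by rewrite lt_neqAle s0 leNgt.
  by rewrite ler_nM2r ?invr_lt0// lerB.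
case: ifPn => sgn.
  rewrite !lebesgue_measure_itv/= !lte_fin ab ltr_pM2r ?invr_gt0//.
  rewrite ltrD2r ab gtr0_norm// -!EFinB -EFinM; congr EFin; field.
  by rewrite gt_eqF.
have sN : s < 0 by rewrite lt_neqAle s0 leNgt.
rewrite !lebesgue_measure_itv/= !lte_fin ab ltr_nM2r ?invr_lt0//.
by rewrite ltrD2r ab ltr0_norm// -!EFinB -EFinM; congr EFin; field.
Qed.

Lemma ge0_integral_affine (s m : R) (f : R -> \bar R) : s != 0 ->
  measurable_fun setT f -> (forall x, 0 <= f x)%E ->
  (\int[leb]_x f x = `|s|%:E * \int[leb]_x f (s * x + m)%R)%E.
Proof.
move=> s0 mf f0.
pose g := (fun x => s * x + m)%R : measurableTypeR R -> measurableTypeR R.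
have ma : measurable_fun setT g.
  exact: measurable_affine.
have := ge0_integral_pushforward ma leb measurableT mf (fun y _ => f0 y).
rewrite preimage_setT => <-.
rewrite -(@ge0_integral_mscale _ _ _ (image_measure leb ma) setT measurableT
  (NngNum (normr_ge0 s)) f)//.
apply: eq_measure_integral => A mA _.
exact: (esym (lebesgue_measure_affine m s0 mA)).
Qed.

End Lebesgue.

(** * Normal densities and their reduction to the standard one *)

Section NormalDensity.
Context {R : realType}.
Notation leb := (@lebesgue_measure R).

(** The Radon-Nikodym derivative of the normal law is known only up to null sets; it is identified
    here with the explicit density. *)
Lemma ge0_integral_normal_prob (m s : R) (f : R -> \bar R) :
  measurable_fun setT f -> (forall x, 0 <= f x)%E ->
  (\int[normal_prob m s]_x f x = \int[leb]_x (f x * (normal_pdf m s x)%:E))%E.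
Proof.
move=> mf f0.
have dom := normal_prob_dominates m s.
rewrite -(Radon_Nikodym_SigmaFinite.change_of_variables dom)//.
have fint := Radon_Nikodym_SigmaFinite.f_integrable dom.
have mpdf : measurable_fun setT (EFin \o normal_pdf m s).
  by apply/measurable_EFinP; exact: measurable_normal_pdf.
apply: ae_eq_integral => //.
- apply: emeasurable_funM => //; exact: (measurable_int _ fint).
- exact: emeasurable_funM.
(* Both functions integrate to the normal law over every measurable set, so they agree almost
   everywhere. *)
- apply: ae_eqe_mul2l; apply: integral_ae_eq => //.
  by move=> E _ mE; rewrite -(Radon_Nikodym_SigmaFinite.f_integral dom mE).
Qed.

Lemma normal_peakZ (s : R) : s != 0 -> `|s| * normal_peak s = normal_peak 1.
Proof.
move=> s0; rewrite /normal_peak expr1n mul1r -mulrnAr sqrtrM ?sqr_ge0//.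
by rewrite sqrtr_sqr invfM mulrA divff ?mul1r// normr_eq0.
Qed.

Lemma normal_pdf_affine (m s y : R) : s != 0 ->
  `|s| * normal_pdf m s (s * y + m) = normal_pdf 0 1 y.
Proof.
move=> s0; rewrite !normal_pdfE ?oner_neq0// mulrA normal_peakZ//.
congr (_ * expR _); rewrite addrK subr0 expr1n exprMn.
by field.
Qed.

(** The substitution [x = s * y + m] standardises the density. A negative [s] is allowed; [s = -1]
    later gives the symmetry of the standard law. *)
Lemma normal_prob_affine (m s : R) (C : set R) : s != 0 -> measurable C ->
  normal_prob m s C = normal_prob 0 1 ((fun y => s * y + m) @^-1` C).
Proof.
move=> s0 mC.
have mC' : measurable ((fun y => s * y + m) @^-1` C).
  by rewrite -[X in measurable X]setTI; exact: measurable_affine.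
rewrite /normal_prob integral_mkcond/= [RHS]integral_mkcond/=.
rewrite (ge0_integral_affine m s0); last 2 first.
- apply/(measurable_restrictT _ _).1 => //.
  by apply/measurable_EFinP/measurable_funTS; exact: measurable_normal_pdf.
- by move=> x; rewrite patchE; case: ifP => // _; rewrite lee_fin normal_pdf_ge0.
rewrite -ge0_integralZl//; last 2 first.
- apply: (measurableT_comp (f := _ \_ _)); last exact: measurable_affine.
  apply/(measurable_restrictT _ _).1 => //.
  by apply/measurable_EFinP/measurable_funTS; exact: measurable_normal_pdf.
- by move=> x _; rewrite patchE; case: ifP => // _; rewrite lee_fin normal_pdf_ge0.
apply: eq_integral => y _; rewrite !patchE.
rewrite (_ : (y \in _ @^-1` C) = (s * y + m \in C)); last first.
  by apply/idP/idP => /set_mem ?; exact/mem_set.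
by case: ifP => _; rewrite ?mule0// -EFinM normal_pdf_affine.
Qed.

End NormalDensity.

(** * The integral of [x ^+ 2 * exp (- x ^+ 2)] over the half-line *)

Section SecondMoment.
Context {R : realType}.
Notation leb := (@lebesgue_measure R).
Import gauss_integral_proof.

(** The bound by [x^-1] comes from [exp (x ^+ 2) >= 1 + x ^+ 2]. This is the boundary term of an
    integration by parts. *)
Lemma cvg_mul_gauss_fun : x * gauss_fun x @[x --> +oo%R] --> (0 : R).
Proof.
apply: (@squeeze_cvgr _ _ _ _ (cst 0) (fun x : R => x^-1)).
- near=> x.
  have x0 : 0 < x by near: x; exact: nbhs_pinfty_gt.
  rewrite /= mulr_ge0 ?gauss_fun_ge0 ?ltW//= /gauss_fun expRN.
  rewrite ltr_pdivrMr ?expR_gt0// -ltr_pdivrMl ?invr_gt0// invrK -expr2.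
  by rewrite (lt_le_trans _ (expR_ge1Dx _))// ltrDr.
- exact: cvg_cst.
- apply/cvgrPdist_lt => e e0; near=> x.
  have x0 : 0 < x by near: x; exact: nbhs_pinfty_gt.
  rewrite sub0r normrN gtr0_norm ?invr_gt0// invf_plt ?posrE//.
  near: x; apply: nbhs_pinfty_gt; exact: num_real.
Unshelve. all: end_near. Qed.

Lemma cvg_integral0_gauss : @integral0_gauss R x @[x --> +oo] --> Num.sqrt pi / 2.
Proof.
have : Num.sqrt (@integral0_gauss R x ^+ 2) @[x --> +oo] --> Num.sqrt (pi / 4).
  by apply: continuous_cvg => //; [exact: sqrt_continuous|exact: cvg_integral0_gauss_sqr].
rewrite sqrtrM ?pi_ge0// sqrtrV// (_ : 4 = 2 ^+ 2); last by rewrite expr2 -natrM.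
rewrite sqrtr_sqr ger0_norm//.
rewrite (_ : (fun _ => Num.sqrt _) = integral0_gauss)//.
apply/funext => r; rewrite sqrtr_sqr ger0_norm//.
exact: integral0_gauss_ge0.
Qed.

Let integrable_gauss (a b : R) : leb.-integrable `[a, b] (EFin \o gauss_fun).
Proof.
apply: continuous_compact_integrable; first exact: segment_compact.
by apply: continuous_subspaceT; exact: continuous_gauss_fun.
Qed.

(** An antiderivative of [x ^+ 2 * gauss_fun x] on the positive axis, found by integrating by
    parts. *)
Let F (x : R) := 2^-1 * (integral0_gauss x - x * gauss_fun x).

Lemma is_derive_gauss_fun (x : R) : is_derive x 1 gauss_fun (- 2 * x * gauss_fun x).
Proof.
rewrite /gauss_fun.
have h : is_derive x (1 : R) (fun y : R => - y ^+ 2) (- (2 * x)).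
  by apply: is_derive_eq; rewrite /GRing.scale/=; ring.
have := @is_derive1_comp R expR (fun y => - y ^+ 2) x _ _ (is_derive_expR _) h.
by rewrite mulrC mulNr.
Qed.

Let dF (x : R) : 0 < x -> is_derive x 1 F (x ^+ 2 * gauss_fun x).
Proof.
move=> x0.
have [d1 d2] : derivable (@integral0_gauss R) x 1 /\
    derive1 (@integral0_gauss R) x = gauss_fun x.
  (* Any right endpoint beyond [x] would do in place of [x + 1]. *)
  apply: (@continuous_FTC1 R gauss_fun (BLeft 0) _ (x + 1)).
  - by rewrite ltrDl.
  - exact: integrable_gauss.
  - by rewrite /= lte_fin.
  - exact: continuous_gauss_fun.
have h : is_derive x 1 (@integral0_gauss R) (gauss_fun x).
  by apply: DeriveDef; [exact: d1|rewrite -derive1E; exact: d2].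
have h2 := is_derive_gauss_fun x.
apply: is_derive_eq.
by rewrite /GRing.scale/=; field.
Qed.

(** [F] vanishes at 0 and tends to [Num.sqrt pi / 4] at infinity. *)
Lemma integral0y_sqr_gauss :
  (\int[leb]_(x in `[0%R, +oo[) (x ^+ 2 * gauss_fun x)%:E = (Num.sqrt pi / 4)%:E)%E.
Proof.
have cts : continuous (fun x : R => x ^+ 2 * gauss_fun x).
  by move=> x; apply: cvgM; [exact: exprn_continuous|exact: continuous_gauss_fun].
rewrite (@ge0_continuous_FTC2y _ _ F 0 (Num.sqrt pi / 4)).
- rewrite /F /integral0_gauss set_itv1 Rintegral_set1 mul0r subrr mulr0.
  by rewrite sube0.
- by move=> x _; rewrite mulr_ge0 ?sqr_ge0 ?gauss_fun_ge0.
- by apply: continuous_subspaceT.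
- rewrite (_ : Num.sqrt pi / 4 = 2^-1 * (Num.sqrt pi / 2 - 0)); last by field.
  apply: cvgM; first exact: cvg_cst.
  apply: cvgB; [exact: cvg_integral0_gauss | exact: cvg_mul_gauss_fun].
- by move=> x x0; apply: ex_derive; exact: dF.
- apply: cvgM; first exact: cvg_cst.
  apply: cvgB; last first.
    apply: cvgM; apply: cvg_at_right_filter; first exact: cvg_id.
    exact: continuous_gauss_fun.
  (* Right continuity of [F] at 0 does not follow from [dF], which concerns positive points; it
     comes from the continuity of the integral in its upper bound. *)
  have := @parameterized_integral_continuous R 0 1 gauss_fun ler01 (integrable_gauss 0 1).
  by move/(continuous_within_itvP _ ltr01) => -[_ + _].
- move=> x; rewrite in_itv/= andbT => x0.
  by rewrite derive1E; apply: derive_val; exact: dF.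
Qed.
End SecondMoment.

(** * Symmetry, mean and variance of the standard normal law *)

Section StandardNormal.
Context {R : realType}.
Notation leb := (@lebesgue_measure R).
Notation N01 := (@normal_prob R 0 1).

Lemma normal_second_moment : (\int[N01]_y (y ^+ 2)%:E = 1)%E.
Proof.
rewrite ge0_integral_normal_prob//; last 2 first.
- by apply/measurable_EFinP; exact: measurable_funX.
- by move=> x; rewrite lee_fin sqr_ge0.
have s2 : 0 < Num.sqrt (2 : R) by rewrite sqrtr_gt0.
(* Scaling by [Num.sqrt 2] turns [exp (- x ^+ 2 / 2)] into [gauss_fun]; evenness then reduces the
   integral to the half-line. *)
rewrite (ge0_integral_affine 0 (lt0r_neq0 s2)); last 2 first.
- apply: emeasurable_funM; apply/measurable_EFinP; first exact: measurable_funX.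
  exact: measurable_normal_pdf.
- by move=> x; rewrite -EFinM lee_fin mulr_ge0 ?sqr_ge0 ?normal_pdf_ge0.
have pi0 : 0 < Num.sqrt (pi : R) by rewrite sqrtr_gt0 pi_gt0.
have -> : (\int[leb]_x (((Num.sqrt 2 * x + 0) ^+ 2)%:E *
      (normal_pdf 0 1 (Num.sqrt 2 * x + 0)%R)%:E) =
    \int[leb]_x ((2 * normal_peak 1)%:E * (x ^+ 2 * gauss_fun x)%:E))%E.
  apply: eq_integral => x _; rewrite -!EFinM; congr EFin.
  rewrite normal_pdfE ?oner_neq0// addr0 exprMn sqr_sqrtr//.
  rewrite /normal_fun /gauss_fun subr0 exprMn sqr_sqrtr// expr1n.
  have -> : - (2 * x ^+ 2) / 2 = - x ^+ 2 by field.
  by ring.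
rewrite ge0_integralZl//; last 3 first.
- apply/measurable_EFinP; apply: measurable_funM; last exact: measurable_gauss_fun.
  exact: measurable_funX.
- by move=> x _; rewrite lee_fin mulr_ge0 ?sqr_ge0 ?gauss_fun_ge0.
- by rewrite lee_fin mulr_ge0// normal_peak_ge0.
rewrite ge0_symfun_integralT; last 3 first.
- by move=> x; rewrite mulr_ge0 ?sqr_ge0 ?gauss_fun_ge0.
- by move=> x; apply: cvgM; [exact: exprn_continuous|exact: continuous_gauss_fun].
- by move=> x /=; rewrite /gauss_fun sqrrN.
rewrite (_ : [set x | _] = `[0, +oo[%classic); last first.
  by apply/seteqP; split => x/=; rewrite in_itv/= andbT.
rewrite integral0y_sqr_gauss -!EFinM; congr EFin.
rewrite gtr0_norm// /normal_peak expr1n mul1r -(mulr_natl pi) (sqrtrM pi)//.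
field.
by rewrite !gt_eqF.
Qed.

(** Reflection amounts to taking the parameter [-1] for the standard deviation, and the density
    depends only on the square of that parameter. *)
Lemma normal_prob_opp (C : set R) : measurable C ->
  N01 (-%R @^-1` C) = N01 C.
Proof.
move=> mC.
transitivity (normal_prob 0 (-1) C).
  rewrite [RHS]normal_prob_affine ?oppr_eq0 ?oner_neq0//; congr (N01 _).
  by apply/funext => y /=; rewrite mulN1r addr0.
rewrite /normal_prob; apply: eq_integral => x _.
rewrite !normal_pdfE ?oppr_eq0 ?oner_neq0//.
by rewrite /normal_peak /normal_fun sqrrN.
Qed.

Lemma integrable_normal_sqr : N01.-integrable setT (fun y : R => (y ^+ 2)%:E).
Proof.
apply/integrableP; split; first by apply/measurable_EFinP; exact: measurable_funX.
under eq_integral => y _ do rewrite gee0_abs ?lee_fin ?sqr_ge0//.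
by rewrite normal_second_moment ltry.
Qed.

(** Domination: [|y| <= 1 + y ^+ 2]. *)
Lemma integrable_normal_id : N01.-integrable setT (fun y : R => y%:E).
Proof.
have int1 : N01.-integrable setT (fun y : R => (1 + y ^+ 2)%:E).
  under eq_fun do rewrite EFinD.
  apply: integrableD => //; last exact: integrable_normal_sqr.
  exact: (finite_measure_integrable_cst N01 1).
apply: (le_integrable measurableT _ _ int1).
  by apply/measurable_EFinP.
move=> y _; rewrite lee_fin [leRHS]ger0_norm ?addr_ge0 ?sqr_ge0//.
by rewrite ler_norml; apply/andP; split; nra.
Qed.

(** By symmetry the mean equals its opposite, and integrability makes it finite, hence zero. *)
Lemma normal_mean : (\int[N01]_y (y%:E) = 0)%E.
Proof.
have mopp : measurable_fun setT (-%R : measurableTypeR R -> measurableTypeR R).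
  by [].
have e : (\int[N01]_y (y%:E) = \int[image_measure N01 mopp]_y (y%:E))%E.
  by apply: eq_measure_integral => A mA _; rewrite -[LHS]normal_prob_opp.
rewrite (integral_pushforward mopp) in e => //; last first.
  by rewrite preimage_setT; exact: (integrableN integrable_normal_id).
move: e; rewrite preimage_setT [X in _ = X -> _](_ : _ = - \int[N01]_y (y%:E))%E; last first.
  rewrite -integralN// fin_num_adde_defl// fin_numN.
  exact: (integrable_neg_fin_num _ integrable_normal_id).
have := integrable_fin_num measurableT integrable_normal_id.
by case: (integral _ _ _) => //= r _ [] e; congr EFin; lra.
Qed.

End StandardNormal.

(** * Moments of a random variable with a possibly degenerate normal law *)

Section GaussLaw.
Context {R : realType}.
Notation N01 := (@normal_prob R 0 1).

(* At [v = 0] both sides are the Dirac mass at [m]. *)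
Lemma gauss_affine (m v : R) (C : set R) : 0 <= v -> measurable C ->
  gauss m v C = N01 ((fun y => Num.sqrt v * y + m) @^-1` C).
Proof.
move=> v0 mC; rewrite /gauss; case: eqVneq => [->|vN0]; last first.
  by rewrite normal_prob_affine// gt_eqF// sqrtr_gt0 lt_def vN0.
rewrite sqrtr0 diracE.
under eq_fun do rewrite mul0r add0r.
rewrite preimage_cst; case: ifPn => _; first by rewrite probability_setT.
by rewrite measure0.
Qed.

Context {d : measure_display} {T : measurableType d} (P : probability T R).
Variables (X : T -> R) (m v : R).
Hypotheses (v0 : 0 <= v) (mX : measurable_fun setT X).
Hypothesis XE : forall C : set R, measurable C -> P (X @^-1` C) = gauss m v C.

Let aff : measurableTypeR R -> measurableTypeR R := fun y => Num.sqrt v * y + m.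

Let maff : measurable_fun setT aff. Proof. exact: measurable_affine. Qed.

Let X' : T -> measurableTypeR R := X.

Let mX' : measurable_fun setT X'. Proof. exact: mX. Qed.

Let X_law (C : set (measurableTypeR R)) : measurable C ->
  pushforward P X' C = pushforward N01 aff C.
Proof. by move=> mC; rewrite /pushforward XE// gauss_affine. Qed.

(** The law of [X] is the image of the standard normal law under [aff]. This representation treats
    [v = 0] and [v > 0] alike. *)
Lemma ge0_integral_gauss_law (f : R -> \bar R) :
  measurable_fun setT f -> (forall x, 0 <= f x)%E ->
  (\int[P]_t f (X t) = \int[N01]_y f (Num.sqrt v * y + m)%R)%E.
Proof.
move=> mf f0.
have := ge0_integral_pushforward mX' P measurableT mf (fun y _ => f0 y).
have := ge0_integral_pushforward maff N01 measurableT mf (fun y _ => f0 y).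
rewrite !preimage_setT => <- <-.
apply: (eq_measure_integral (image_measure N01 maff)
  (m1 := image_measure P mX')).
by move=> A mA _; exact: X_law.
Qed.

Lemma gauss_law_sqr_center : (\int[P]_t ((X t - m) ^+ 2)%:E = v%:E)%E.
Proof.
rewrite (@ge0_integral_gauss_law (fun x => ((x - m) ^+ 2)%:E)); last 2 first.
- by apply/measurable_EFinP; apply: measurable_funX; exact: measurable_funB.
- by move=> x; rewrite lee_fin sqr_ge0.
under eq_integral => y _ do rewrite addrK exprMn sqr_sqrtr// EFinM.
rewrite ge0_integralZl ?normal_second_moment ?mule1//.
- by apply/measurable_EFinP; exact: measurable_funX.
- by move=> x _; rewrite lee_fin sqr_ge0.
Qed.

Lemma integrable_gauss_law : P.-integrable setT (EFin \o X).
Proof.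
apply/integrableP; split; first exact/measurable_EFinP.
rewrite (@ge0_integral_gauss_law (fun x => `|x%:E|%E)).
- have: N01.-integrable setT (fun y : R => (Num.sqrt v * y + m)%:E).
    under eq_fun do rewrite EFinD EFinM.
    apply: integrableD => //.
      exact: (integrableZl measurableT (Num.sqrt v) integrable_normal_id).
    exact: (finite_measure_integrable_cst N01 m).
  by move/integrableP => [].
- by apply: measurableT_comp => //; exact/measurable_EFinP.
- by move=> x; exact: abse_ge0.
Qed.

Lemma gauss_law_mean : (\int[P]_t (X t)%:E = m%:E)%E.
Proof.
have mE : measurable_fun setT (EFin : measurableTypeR R -> _) by exact/measurable_EFinP.
have iaff : N01.-integrable setT (fun y : R => (Num.sqrt v * y + m)%:E).
  under eq_fun do rewrite EFinD EFinM.
  apply: integrableD => //.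
    exact: (integrableZl measurableT (Num.sqrt v) integrable_normal_id).
  exact: (finite_measure_integrable_cst N01 m).
(* The integrand changes sign, so the transfer relies on integrability on both sides instead of
   nonnegativity. *)
have := @integral_pushforward _ _ _ _ _ _ mX' P setT EFin mE _ measurableT.
have := @integral_pushforward _ _ _ _ _ _ maff N01 setT EFin mE _ measurableT.
rewrite !preimage_setT => /(_ iaff) e1 /(_ integrable_gauss_law) e2.
transitivity (\int[pushforward P X']_y y%:E)%E; first by rewrite e2.
transitivity (\int[pushforward N01 aff]_y y%:E)%E.
  apply: (eq_measure_integral (image_measure N01 maff)
    (m1 := image_measure P mX')).
  by move=> A mA _; exact: X_law.
rewrite e1 /=.
under eq_integral do rewrite EFinD EFinM.
rewrite integralD//; last 2 first.
- exact: (integrableZl measurableT (Num.sqrt v) integrable_normal_id).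
- exact: (finite_measure_integrable_cst N01 m).
rewrite integralZl//; last exact: integrable_normal_id.
rewrite normal_mean mule0 add0e integral_cst//= -[RHS]mule1.
by congr (_ * _)%E; exact: (@probability_setT _ _ _ N01).
Qed.

Lemma gauss_law_center_Lfun2 : (fun t => X t - m) \in Lfun P 2%:E.
Proof.
have mXm : measurable_fun setT (fun t => X t - m) by exact: measurable_funB.
rewrite inE; apply/andP; split; rewrite inE//= /finite_norm unlock.
apply: poweR_lty.
under eq_integral => t _ do rewrite /= powR_mulrn// real_normK ?num_real//.
by rewrite gauss_law_sqr_center ltry.
Qed.

End GaussLaw.

(** * The standard normal distribution function and its quantiles *)

Section PhiTheory.
Context {R : realType}.
Notation leb := (@lebesgue_measure R).
Notation N01 := (@normal_prob R 0 1).

Let mpdf (D : set R) : measurable_fun D (EFin \o normal_pdf (0 : R) 1).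
Proof. by apply/measurable_EFinP/measurable_funTS; exact: measurable_normal_pdf. Qed.

(** The density is at most its peak; this makes [Phi] Lipschitz, hence continuous. *)
Lemma normal_prob_itvoc_le (a b : R) : a <= b ->
  (N01 `]a, b] <= (normal_peak 1 * (b - a))%:E)%E.
Proof.
move=> ab; rewrite /normal_prob.
apply: (@le_trans _ _ (\int[leb]_(x in `]a, b]) (cst (normal_peak 1)%:E x)))%E.
  apply: ge0_le_integral => //.
  - by move=> x _; rewrite lee_fin normal_pdf_ge0.
  - exact: mpdf.
  - by move=> x _; rewrite lee_fin normal_pdf_ub ?oner_neq0.
rewrite integral_cst//= lebesgue_measure_itv/= lte_fin EFinM.
move: ab; rewrite le_eqVlt => /predU1P[->|->//].
by rewrite ltxx subrr.
Qed.

(** On this interval the density is at least its value at [a]. *)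
Lemma normal_prob_itvoc_gt0 (a : R) : a < 0 -> (0 < N01 `]a, 0%R])%E.
Proof.
move=> a0.
apply: (@lt_le_trans _ _ (\int[leb]_(x in `]a, 0%R]) (cst (normal_pdf 0 1 a)%:E x)))%E.
  rewrite integral_cst//= lebesgue_measure_itv/= lte_fin a0 -EFinB -EFinM lte_fin.
  rewrite mulr_gt0 ?subr_gt0// normal_pdfE ?oner_neq0//.
  by rewrite mulr_gt0 ?expR_gt0 ?normal_peak_gt0 ?oner_neq0.
apply: ge0_le_integral => //.
- by move=> x _; rewrite lee_fin normal_pdf_ge0.
- exact: mpdf.
- move=> x /=; rewrite in_itv/= => /andP[ax x0]; rewrite lee_fin.
  rewrite !normal_pdfE ?oner_neq0// ler_wpM2l ?normal_peak_ge0//.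
  rewrite ler_expR !subr0 expr1n ler_pM2r ?invr_gt0// lerN2.
  by rewrite -sqrrN -[leRHS]sqrrN lerXn2r ?nnegrE ?oppr_ge0 ?lerN2// ltW.
Qed.

Lemma PhiE (z : R) : ((Phi z)%:E = N01 `]-oo, z])%E.
Proof. by rewrite /Phi fineK// fin_num_measure. Qed.

Lemma PhiD (a b : R) : a <= b -> ((Phi b)%:E = (Phi a)%:E + N01 `]a, b])%E.
Proof.
move=> ab; rewrite !PhiE -measureU//.
- by congr (N01 _); rewrite -itv_bndbnd_setU// bnd_simp.
- apply/seteqP; split => x //= []; rewrite !in_itv/= => xa /andP[].
  by rewrite ltNge xa.
Qed.

Lemma Phi_lipschitz (a b : R) : a <= b ->
  0 <= Phi b - Phi a <= normal_peak 1 * (b - a).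
Proof.
move=> ab; have := PhiD ab; have := normal_prob_itvoc_le ab.
have : (0 <= N01 `]a, b])%E by exact: measure_ge0.
case: (N01 `]a, b]) => //= r; rewrite !lee_fin => r0 ru [->].
by rewrite addrAC subrr add0r r0.
Qed.

Lemma continuous_Phi : continuous (@Phi R).
Proof.
move=> x; apply/cvgrPdist_lt => e e0.
have k0 : 0 < normal_peak (1 : R) by rewrite normal_peak_gt0 ?oner_neq0.
near=> y.
have : `|x - y| < e / normal_peak 1.
  by near: y; apply: cvgr_dist_lt => //; rewrite divr_gt0.
rewrite ltr_pdivlMr// mulrC; apply: le_lt_trans.
have [xy|/ltW yx] := leP x y.
  have /andP[h1 h2] := Phi_lipschitz xy.
  by rewrite distrC [leLHS]ger0_norm// (le_trans h2)// ler_pM2l// distrC ler_norm.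
have /andP[h1 h2] := Phi_lipschitz yx.
by rewrite [leLHS]ger0_norm// (le_trans h2)// ler_pM2l// ler_norm.
Unshelve. all: end_near. Qed.

(** The two half-lines have equal mass by symmetry, and the point 0 has none. *)
Lemma Phi0 : Phi 0 = 2^-1 :> R.
Proof.
have N1 : (N01 setT = 1)%E by exact: probability_setT.
have h : (N01 `]-oo, 0%R] = N01 `]0%R, +oo[)%E.
  have -> : N01 `]0%R, +oo[ = N01 `[0%R, +oo[.
    rewrite -(@setU1itv _ _ _ _ false)// measureU//.
      rewrite [X in (_ = X + _)%E](_ : _ = 0%E) ?add0e//.
      exact: integral_set1.
    by apply/seteqP; split => x //= [->]; rewrite in_itv/= ltxx.
  rewrite -normal_prob_opp//; congr (N01 _).
  by apply/seteqP; split => x /=; rewrite !in_itv/= andbT oppr_le0.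
have : (N01 `]-oo, 0%R] + N01 `]0%R, +oo[ = 1)%E.
  rewrite -N1 -measureU//.
    by congr (N01 _); apply/seteqP; split => x //= _; rewrite !in_itv/= andbT; case: leP; [left|right].
  by apply/seteqP; split => x //= []; rewrite !in_itv/= andbT leNgt => /negbTE ->.
rewrite -h -PhiE => -[e].
by apply/eqP; rewrite -(inj_eq (mulfI (_ : 2 != 0)))// mulfV// mulr_natl mulr2n e.
Qed.

(** The half-lines up to [n] exhaust the reals, so their masses tend to 1. The point [b] serves as
    right endpoint in the intermediate value theorem. *)
Lemma Phi_ge (q : R) : q < 1 -> exists2 b, 0 <= b & q <= Phi b.
Proof.
move=> q1.
have N1 : (N01 setT = 1)%E by exact: probability_setT.
have cv : N01 `]-oo, n%:R] @[n --> \oo] --> 1%E.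
  rewrite -N1.
  have <- : \bigcup_n [set` `]-oo, (n%:R : R)]] = setT.
    rewrite -subTset => t _/=.
    by exists (Num.truncn t).+1; rewrite //= in_itv/= ltW// truncnS_gt.
  apply: nondecreasing_cvg_mu => //; first exact: bigcup_measurable.
  move=> n m nm; apply/subsetPset => x/=; rewrite !in_itv/= => /le_trans.
  by apply; rewrite ler_nat.
have [//|nq] := pselect (exists2 b, 0 <= b & q <= Phi b).
suff : (1 <= q%:E)%E by rewrite lee_fin leNgt q1.
apply: (cvge_to_le cv); apply: nearW => n; rewrite -PhiE lee_fin ltW// ltNge.
by apply/negP => qn; apply: nq; exists n%:R.
Qed.

Lemma Phi_invP (q : R) : 2^-1 <= q < 1 ->
  0 <= Phi_inv q /\ Phi (Phi_inv q) = q.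
Proof.
move=> /andP[q2 q1].
have [b b0 qb] := Phi_ge q1.
have [] := @IVT R (@Phi R) 0 b q b0.
- by apply: continuous_subspaceT; exact: continuous_Phi.
- by rewrite Phi0 ge_min q2 le_max qb orbT.
move=> c _ cq.
have PE : Phi (Phi_inv q) = q by rewrite /Phi_inv; exact: (@getI _ [set z | Phi z = q] c cq).
(* Whichever preimage [get] returns, a negative one would have [Phi] strictly below
   [Phi 0 = 2^-1 <= q]. *)
split=> //; rewrite leNgt; apply/negP => z0.
have := PhiD (ltW z0); have := normal_prob_itvoc_gt0 z0.
rewrite PE Phi0; case: (N01 _) => //= t; rewrite lte_fin => t0 [e].
by move: q2; rewrite e leNgt ltrDl t0.
Qed.

End PhiTheory.

(** * Sums of independent normal variables *)

Section Convolution.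
Context {R : realType}.
Notation leb := (@lebesgue_measure R).

Lemma normal_pdf_peakE (m s x : R) : s != 0 ->
  normal_pdf m s x = normal_peak s * normal_fun m s x.
Proof. by move=> s0; rewrite normal_pdfE. Qed.

(* The second factor is the density of a summand given that the sum is [z]. *)
Lemma normal_pdf_conv (m1 m2 s1 s2 y z : R) : s1 != 0 -> s2 != 0 ->
  let s := Num.sqrt (s1 ^+ 2 + s2 ^+ 2) in
  normal_pdf m1 s1 (z - y) * normal_pdf m2 s2 y =
  normal_pdf (m1 + m2) s z *
  normal_pdf (m2 + s2 ^+ 2 * (z - m1 - m2) / s ^+ 2) (s1 * s2 / s) y.
Proof.
move=> s10 s20 s.
have s1p : 0 < s1 ^+ 2 by rewrite exprn_even_gt0.
have s2p : 0 < s2 ^+ 2 by rewrite exprn_even_gt0.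
have sE : s ^+ 2 = s1 ^+ 2 + s2 ^+ 2 by rewrite sqr_sqrtr// addr_ge0 ?sqr_ge0.
have sp : 0 < s by rewrite sqrtr_gt0 addr_gt0.
have tn0 : s1 * s2 / s != 0 by rewrite !mulf_neq0// invr_eq0 gt_eqF.
rewrite !normal_pdf_peakE ?(gt_eqF sp)//.
have pk : normal_peak s1 * normal_peak s2 = normal_peak s * normal_peak (s1 * s2 / s).
  have nn (t : R) : 0 <= t ^+ 2 * pi *+ 2.
    by rewrite mulrn_wge0// mulr_ge0 ?pi_ge0// sqr_ge0.
  rewrite /normal_peak -!invfM -!sqrtrM ?nn//.
  congr (Num.sqrt _)^-1; rewrite expr_div_n exprMn.
  by field; rewrite gt_eqF.
rewrite mulrACA pk [RHS]mulrACA; congr (_ * _).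
rewrite /normal_fun -!expRD expr_div_n exprMn; congr expR.
rewrite sE; field.
by rewrite s10 s20 gt_eqF// addr_gt0.
Qed.

(** After Tonelli, [normal_pdf_conv] factors the integrand for each value [z] of the sum: the
    density of the sum comes out, and the remaining normal density in [y] has integral 1. *)
Lemma integral_normal_conv (m1 m2 s1 s2 : R) (C : set R) :
  s1 != 0 -> s2 != 0 -> measurable C ->
  (\int[normal_prob m2 s2]_y normal_prob m1 s1 ((fun x => x + y)%R @^-1` C) =
   normal_prob (m1 + m2)%R (Num.sqrt (s1 ^+ 2 + s2 ^+ 2)) C)%E.
Proof.
move=> s10 s20 mC; set s := Num.sqrt _.
have s1p : 0 < s1 ^+ 2 by rewrite exprn_even_gt0.
have s2p : 0 < s2 ^+ 2 by rewrite exprn_even_gt0.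
have sN0 : s != 0 by rewrite gt_eqF// sqrtr_gt0 addr_gt0.
(* Here [u.1] is the sum and [u.2] the second summand. *)
pose q (u : R * R) : \bar R := (normal_pdf m1 s1 (u.1 - u.2) * \1_C u.1)%:E.
pose p (u : R * R) : \bar R := (q u * (normal_pdf m2 s2 u.2)%:E)%E.
have mpdf m t : measurable_fun setT (normal_pdf m t : R -> R).
  exact: measurable_normal_pdf.
have mq : measurable_fun setT q.
  apply/measurable_EFinP; apply: measurable_funM; last first.
    by apply: measurableT_comp => //; exact: measurable_indic.
  by apply: measurableT_comp => //; exact: measurable_funB.
have mp : measurable_fun setT p.
  apply: emeasurable_funM => //; apply/measurable_EFinP.
  exact: measurableT_comp.
have q0 u : (0 <= q u)%E by rewrite lee_fin mulr_ge0 ?normal_pdf_ge0.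
have p0 u : (0 <= p u)%E by rewrite mule_ge0// lee_fin normal_pdf_ge0.
have inner y : (normal_prob m1 s1 ((fun x => x + y)%R @^-1` C) =
    \int[leb]_x q (x, y))%E.
  rewrite /normal_prob integral_mkcond/=.
  rewrite [RHS](ge0_integral_affine y (oner_neq0 R)).
  - rewrite normr1 mul1e; apply: eq_integral => x _.
    rewrite patchE /q /= mul1r addrK indicE.
    rewrite (_ : (x \in _ @^-1` C) = (x + y \in C)); last first.
      by apply/idP/idP => /set_mem ?; exact/mem_set.
    by case: ifP => _; rewrite ?mulr0// mulr1.
  - exact: measurableT_comp.
  - by [].
rewrite ge0_integral_normal_prob; last 2 first.
- rewrite (_ : (fun y => _) = fubini_G leb q); last by apply/funext.
  exact: measurable_fun_fubini_tonelli_G.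
- by move=> y; exact: measure_ge0.
transitivity (\int[leb]_y \int[leb]_x p (x, y))%E.
  apply: eq_integral => y _; rewrite inner -ge0_integralZr//.
  - exact: measurableT_comp.
  - by rewrite lee_fin normal_pdf_ge0.
have := fubini_tonelli (m1 := leb) (m2 := leb) p mp p0.
rewrite /fubini_F /fubini_G => <-.
rewrite /normal_prob [RHS]integral_mkcond/=; apply: eq_integral => z _.
(* [m] and [t] are the mean and standard deviation of the second summand conditioned on the sum
   being [z]. *)
pose m := m2 + s2 ^+ 2 * (z - m1 - m2) / s ^+ 2.
pose t := s1 * s2 / s.
transitivity (\int[leb]_y ((normal_pdf (m1 + m2) s z * \1_C z)%:E * (normal_pdf m t y)%:E))%E.
  apply: eq_integral => y _; rewrite /p /q /= -!EFinM; congr EFin.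
  by rewrite mulrAC normal_pdf_conv// mulrAC.
rewrite ge0_integralZl//; last 3 first.
- by apply/measurable_EFinP; exact: mpdf.
- by move=> y _; rewrite lee_fin normal_pdf_ge0.
- by rewrite lee_fin mulr_ge0 ?normal_pdf_ge0.
rewrite integral_normal_pdf mule1 patchE indicE.
by case: ifP => _; rewrite ?mulr0 ?mulr1.
Qed.

(** [gauss] with its structure of probability measure, so that integrals against it and products can
    be formed. *)
Definition gauss_prob (m v : R) : probability (measurableTypeR R) R :=
  if v == 0 then dirac (m : measurableTypeR R) : probability (measurableTypeR R) R
  else normal_prob m (Num.sqrt v).

Lemma gauss_probE (m v : R) (C : set R) : gauss_prob m v C = gauss m v C.
Proof. by rewrite /gauss_prob /gauss; case: ifP. Qed.

Lemma gauss_shift (m v c : R) (C : set R) : 0 <= v -> measurable C ->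
  gauss m v ((fun x => x + c) @^-1` C) = gauss (m + c) v C.
Proof.
move=> v0 mC; rewrite !gauss_affine//.
  by congr (normal_prob _ _ _); apply/funext => y /=; rewrite addrA.
by rewrite -[X in measurable X]setTI; apply: measurable_funD.
Qed.

(** If one variance is zero, that law is a Dirac mass and the convolution is a translation;
    otherwise both laws have densities. *)
Lemma integral_gauss_conv (m1 m2 v1 v2 : R) (C : set R) :
  0 <= v1 -> 0 <= v2 -> measurable C ->
  (\int[gauss_prob m2 v2]_y gauss m1 v1 ((fun x => x + y)%R @^-1` C) =
   gauss (m1 + m2) (v1 + v2) C)%E.
Proof.
move=> v10 v20 mC.
have [->|v1N0] := eqVneq v1 0.
  rewrite add0r addrC -gauss_shift// -gauss_probE.
  have mC1 : measurable ((fun x => x + m1) @^-1` C).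
    by rewrite -[X in measurable X]setTI; apply: measurable_funD.
  rewrite -[X in _ = gauss_prob m2 v2 X]setIT -integral_indic//.
  apply: eq_integral => y _; rewrite /gauss eqxx diracE indicE.
  congr (_%:R%:E); congr (nat_of_bool _).
  by apply/idP/idP => /set_mem /= h; apply/mem_set; rewrite /= addrC.
have [->|v2N0] := eqVneq v2 0.
  rewrite addr0 -gauss_shift// /gauss_prob eqxx.
  rewrite integral_dirac// ?diracT ?mul1e//.
  pose f := (fun u : measurableTypeR R * measurableTypeR R => u.2 + u.1 : measurableTypeR R).
  have mf : measurable_fun setT f.
    exact: (measurable_funD measurable_snd measurable_fst).
  have mA : measurable (f @^-1` C).
    by rewrite -[X in measurable X]setTI; exact: mf.
  (* The integrand is the mass of the sections of the set of pairs with sum in [C], hence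
     measurable. *)
  have := measurable_fun_xsection (gauss_prob m1 v1) mA.
  apply: eq_measurable_fun => y _ /=; rewrite gauss_probE; congr (gauss _ _ _).
  by apply/seteqP; split => x; rewrite /xsection /= in_setE.
have s1 : Num.sqrt v1 != 0 by rewrite sqrtr_eq0 -ltNge lt_def v1N0.
have s2 : Num.sqrt v2 != 0 by rewrite sqrtr_eq0 -ltNge lt_def v2N0.
rewrite /gauss_prob /gauss (negbTE v1N0) (negbTE v2N0).
rewrite (paddr_eq0 v10 v20) (negbTE v1N0)/=.
rewrite (integral_normal_conv m1 m2 s1 s2 mC).
by rewrite (sqr_sqrtr v10) (sqr_sqrtr v20).
Qed.

Context {d : measure_display} {T : measurableType d} (P : probability T R).

(** Independence makes the joint law a product measure, because the two agree on rectangles; its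
    value on the pairs with sum in [C] is the convolution integral. *)
Lemma gauss_law_add (X W : T -> R) (m1 m2 v1 v2 : R) :
  measurable_fun setT X -> measurable_fun setT W -> 0 <= v1 -> 0 <= v2 ->
  (forall C, measurable C -> P (X @^-1` C) = gauss m1 v1 C) ->
  (forall C, measurable C -> P (W @^-1` C) = gauss m2 v2 C) ->
  (forall C E, measurable C -> measurable E ->
    P (X @^-1` C `&` W @^-1` E) = (P (X @^-1` C) * P (W @^-1` E))%E) ->
  forall C, measurable C ->
    P ((fun t => X t + W t) @^-1` C) = gauss (m1 + m2) (v1 + v2) C.
Proof.
move=> mX mW v10 v20 XE WE ind C mC.
pose f := (fun u : measurableTypeR R * measurableTypeR R => u.2 + u.1 : measurableTypeR R).
have mf : measurable_fun setT f.
  exact: (measurable_funD measurable_snd measurable_fst).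
have mA : measurable (f @^-1` C).
  by rewrite -[X in measurable X]setTI; exact: mf.
(* [W] comes first so that its law is the outer measure of the iterated integral. *)
pose Y (t : T) : measurableTypeR R * measurableTypeR R := (W t, X t).
have mY : measurable_fun setT Y by apply/measurable_fun_pairP; split.
rewrite -integral_gauss_conv//.
transitivity ((gauss_prob m2 v2 \x gauss_prob m1 v1)%E (f @^-1` C)).
  rewrite (@product_measure_unique _ _ _ _ _ _ _ (image_measure P mY))//.
  move=> D E mD mE; transitivity (gauss m2 v2 D * gauss m1 v1 E)%E.
    by rewrite -XE// -WE// muleC -ind// setIC.
  by congr (_ * _)%E; rewrite -gauss_probE.
apply: eq_integral => y _ /=; rewrite gauss_probE; congr (gauss _ _ _).
by apply/seteqP; split => x; rewrite /xsection /= in_setE.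
Qed.

End Convolution.

(** * Linear forms of normal vectors *)

Section Forms.
Context {R : realType}.

Lemma dotE n (a x : 'cV[R]_n) : dot a x = \sum_i a i 0 * x i 0.
Proof. by rewrite /dot mxE; apply: eq_bigr => i _; rewrite mxE. Qed.

Lemma dotDr n (a x y : 'cV[R]_n) : dot a (x + y) = dot a x + dot a y.
Proof. by rewrite /dot mulmxDr mxE. Qed.

Lemma dotBr n (a x y : 'cV[R]_n) : dot a (x - y) = dot a x - dot a y.
Proof. by rewrite /dot mulmxBr !mxE. Qed.

Lemma dotDl n (a b x : 'cV[R]_n) : dot (a + b) x = dot a x + dot b x.
Proof. by rewrite /dot linearD mulmxDl mxE. Qed.

Lemma dot_mulmx m n (a : 'cV[R]_m) (M : 'M[R]_(m, n)) (x : 'cV[R]_n) :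
  dot a (M *m x) = dot (M^T *m a) x.
Proof. by rewrite /dot trmx_mul trmxK mulmxA. Qed.

Lemma dot_delta n (i : 'I_n) (x : 'cV[R]_n) : dot (delta_mx i 0) x = x i 0.
Proof. by rewrite /dot trmx_delta -rowE mxE. Qed.

Lemma quad_congr m n (M : 'M[R]_(m, n)) (S : 'M[R]_n) (a : 'cV[R]_m) :
  quad (M *m S *m M^T) a = quad S (M^T *m a).
Proof. by rewrite /quad trmx_mul trmxK !mulmxA. Qed.

Lemma quadD n (S T : 'M[R]_n) a : quad (S + T) a = quad S a + quad T a.
Proof. by rewrite /quad mulmxDr mulmxDl mxE. Qed.

Lemma quadB n (S T : 'M[R]_n) a : quad (S - T) a = quad S a - quad T a.
Proof. by rewrite /quad mulmxBr mulmxBl !mxE. Qed.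

Lemma quadDr n (S : 'M[R]_n) (a b : 'cV[R]_n) : S^T = S ->
  quad S (a + b) = quad S a + 2 * (a^T *m S *m b) 0 0 + quad S b.
Proof.
move=> Ssym.
have e : (b^T *m S *m a) 0 0 = (a^T *m S *m b) 0 0.
  have -> : b^T *m S *m a = (a^T *m S *m b)^T.
    by rewrite !trmx_mul trmxK Ssym mulmxA.
  by rewrite mxE.
have tD : (a + b)^T = a^T + b^T by rewrite linearD.
rewrite /quad tD !mulmxDl !mulmxDr.
rewrite [LHS]mxE [(a^T *m S *m a + _) 0 0]mxE [(b^T *m S *m a + _) 0 0]mxE e.
by ring.
Qed.

End Forms.

(** * Borel measurability of affine maps between vector spaces *)

Section Borel.
Context {R : realType}.

Lemma measurable_dot d (T : measurableType d) n (x : T -> 'cV[R]_n) (a : 'cV[R]_n) :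
  (forall i, measurable_fun setT (fun t => x t i 0)) ->
  measurable_fun setT (fun t => dot a (x t)).
Proof.
move=> mx; under eq_fun do rewrite dotE.
elim: (index_enum _) => [|i s IH].
  by under eq_fun do rewrite big_nil; exact: measurable_cst.
under eq_fun do rewrite big_cons.
by apply: measurable_funD => //; exact: measurable_funM.
Qed.

(** Vectors as a measurable type whose measurable sets are those of [borel], so that
    [measurable_fun] lemmas apply. *)
Let borelType n := g_sigma_algebraType (\big[setU/set0]_(i < n)
  preimage_set_system setT (fun x : 'cV[R]_n => x i 0) measurable).

Lemma measurable_coord n (i : 'I_n) :
  measurable_fun setT (fun x : borelType n => x i 0).
Proof.
move=> _ C mC; rewrite setTI; apply: sub_sigma_algebra.
by rewrite (bigD1 i)//=; left; exists C => //; rewrite setTI.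
Qed.

Lemma borel_dot n (a : 'cV[R]_n) (c : R) (C : set R) : measurable C ->
  borel [set x : 'cV[R]_n | C (dot a x + c)].
Proof.
move=> mC.
have mf : measurable_fun setT (fun x : borelType n => dot a x + c).
  by apply: measurable_funD => //; apply: measurable_dot; exact: measurable_coord.
by have := mf measurableT C mC; rewrite setTI.
Qed.

(** It suffices to test preimages of generators, and each coordinate of the image is a linear form
    plus a constant. *)
Lemma borel_fun_affine m n (M : 'M[R]_(m, n)) (c : 'cV[R]_m) :
  borel_fun (fun x => M *m x + c).
Proof.
have mf : measurable_fun setT (fun x : borelType n => (M *m x + c : borelType m)).
  apply: measurability => // _ [C GC <-].
  have : exists i : 'I_m, preimage_set_system setT (fun x : 'cV[R]_m => x i 0) measurable C.
    elim/big_ind: _ GC => [//|A B hA hB [/hA|/hB]//|i _ hC]; by exists i.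
  move=> [i [E mE <-]]; rewrite !setTI.
  have := @borel_dot n (M^T *m delta_mx i 0) (c i 0) E mE.
  have ext (x : 'cV[R]_n) :
    dot (M^T *m delta_mx i 0) x + c i 0 = (M *m x + c) i 0.
    by rewrite -dot_mulmx dot_delta [RHS]mxE.
  by congr (borel _); apply/seteqP; split => x /=; rewrite ext.
by move=> C mC; have := mf measurableT C mC; rewrite setTI.
Qed.

End Borel.

(** * Moments, affine images and chance constraints of normal vectors *)

Section NormalVectors.
Context {R : realType} {d : measure_display} {T : measurableType d}.
Variable P : probability T R.

Lemma quad_ge0 n (S : 'M[R]_n) a : psd S -> 0 <= quad S a.
Proof. by case. Qed.

Lemma psd_congr m n (M : 'M[R]_(m, n)) (S : 'M[R]_n) :
  psd S -> psd (M *m S *m M^T).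
Proof.
move=> [Ssym S0]; split=> [|a]; last by rewrite quad_congr.
by rewrite !trmx_mul trmxK Ssym mulmxA.
Qed.

Lemma psdD n (S U : 'M[R]_n) : psd S -> psd U -> psd (S + U).
Proof.
move=> [Ss S0] [Us U0]; split=> [|a]; first by rewrite linearD /= Ss Us.
by rewrite quadD addr_ge0.
Qed.

Section Form.
Context {n : nat} {x : T -> 'cV[R]_n} {mu : 'cV[R]_n} {S : 'M[R]_n}.
Hypothesis xN : normal_vector P x mu S.

Lemma normal_vector_measurable_dot (a : 'cV[R]_n) :
  measurable_fun setT (fun t => dot a (x t)).
Proof. by case: xN => _ mx _; exact: measurable_dot. Qed.

Lemma normal_vector_form (a : 'cV[R]_n) (c : R) (C : set R) : measurable C ->
  P ((fun t => dot a (x t) + c) @^-1` C) = gauss (dot a mu + c) (quad S a) C.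
Proof.
move=> mC; case: xN => Spsd _ xE.
have mC1 : measurable ((fun y => y + c) @^-1` C).
  by rewrite -[X in measurable X]setTI; apply: measurable_funD.
by rewrite -gauss_shift ?quad_ge0// -xE.
Qed.

Let Y (a : 'cV[R]_n) (t : T) : R := dot a (x t - mu).

Let law a (C : set R) : measurable C ->
  P ((fun t => dot a (x t)) @^-1` C) = gauss (dot a mu) (quad S a) C.
Proof. by move=> mC; case: xN => _ _; exact. Qed.

Let quad_ge0S a : 0 <= quad S a. Proof. by case: xN => + _ _; exact: quad_ge0. Qed.

Lemma normal_vector_Lfun2 (a : 'cV[R]_n) (c : R) :
  (fun t => dot a (x t - mu) + c) \in Lfun P 2%:E.
Proof.
apply: (@rpredD _ _ (fun t => dot a (x t - mu)) (cst c)).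
- by rewrite lee1n.
- move=> ?; under eq_fun do rewrite dotBr.
  exact: (gauss_law_center_Lfun2 (quad_ge0S a) (normal_vector_measurable_dot a) (@law a)).
- by move=> ?; exact: Lfun_cst.
Qed.

Let L2 a : Y a \in Lfun P 2%:E.
Proof. by rewrite (_ : Y a = fun t => Y a t + 0) ?normal_vector_Lfun2//; apply/funext => t; rewrite addr0. Qed.

Lemma normal_vector_mean_affine (a : 'cV[R]_n) (c : R) :
  ('E_P[fun t => (dot a (x t - mu) + c)%R] = c%:E)%E.
Proof.
rewrite unlock; under eq_integral do rewrite dotBr -addrA EFinD.
rewrite integralD//; last 2 first.
- exact: (integrable_gauss_law (quad_ge0S a) (normal_vector_measurable_dot a) (@law a)).
- exact: (finite_measure_integrable_cst P (- dot a mu + c)).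
rewrite (gauss_law_mean (quad_ge0S a) (normal_vector_measurable_dot a) (@law a)).
rewrite integral_cst//= probability_setT mule1 -EFinD; congr EFin.
by rewrite addrA subrr add0r.
Qed.

(** Polarisation: the definition of normality gives the variances of the forms [a], [b] and [a + b],
    and these determine the covariance. *)
Lemma normal_vector_cov (a b : 'cV[R]_n) :
  ('E_P[fun t => (dot a (x t - mu) * dot b (x t - mu))%R] = ((a^T *m S *m b) 0 0)%:E)%E.
Proof.
have Ssym : S^T = S by case: xN => -[].
have sq c : (\int[P]_t (Y c t ^+ 2)%:E = (quad S c)%:E)%E.
  under eq_integral do rewrite /Y dotBr.
  exact: (gauss_law_sqr_center (quad_ge0S c) (normal_vector_measurable_dot c) (@law c)).
have isq c : P.-integrable setT (fun t => (Y c t ^+ 2)%:E) by exact: Lfun2_integrable_sqr.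
have iab : P.-integrable setT (fun t => (Y a t * Y b t)%:E).
  by apply/Lfun1_integrable; exact: Lfun2_mul_Lfun1.
rewrite unlock -/(Y a) -/(Y b).
have := sq (a + b); under eq_integral => t _.
  rewrite (_ : Y (a + b) t ^+ 2 = Y a t ^+ 2 + (2 * (Y a t * Y b t) + Y b t ^+ 2)); last first.
    by rewrite /Y dotDl; ring.
  rewrite EFinD EFinD (EFinM 2); over.
have i2ab := integrableZl measurableT 2 iab.
rewrite integralD//; last exact: (integrableD measurableT i2ab (isq b)).
rewrite integralD//.
rewrite integralZl// !sq quadDr//.
have := integrable_fin_num measurableT iab.
case: (integral _ _ _) => //= r _; rewrite -!EFinM -!EFinD => -[e]; congr EFin.
lra.
Qed.

End Form.

(** Each linear form of the result splits into a form of [x] and a form of [w], which inherit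
    independence, so [gauss_law_add] applies. *)
Lemma normal_vector_affine_add m n k (M : 'M[R]_(k, m)) (N : 'M[R]_(k, n)) c
    (x : T -> 'cV[R]_m) (w : T -> 'cV[R]_n) mu S nu U :
  normal_vector P x mu S -> normal_vector P w nu U -> independent P x w ->
  normal_vector P (fun t => M *m x t + N *m w t + c) (M *m mu + N *m nu + c)
    (M *m S *m M^T + N *m U *m N^T).
Proof.
move=> xN wN ind.
have [Sp _ _] := xN; have [Up _ _] := wN.
(* The constant is absorbed into the second summand, leaving a sum of two random terms. *)
have dE a (y : 'cV[R]_m) (z : 'cV[R]_n) :
    dot a (M *m y + N *m z + c) = dot (M^T *m a) y + (dot (N^T *m a) z + dot a c).
  by rewrite !dotDr !dot_mulmx addrA.
have mX a := normal_vector_measurable_dot xN a.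
have mW a : measurable_fun setT (fun t => dot (N^T *m a) (w t) + dot a c).
  by apply: measurable_funD => //; exact: (normal_vector_measurable_dot wN).
split.
- by apply: psdD; exact: psd_congr.
- move=> i; under eq_fun do rewrite -dot_delta dE.
  exact: measurable_funD.
- move=> a C mC; rewrite quadD !quad_congr dE.
  have <-// := @gauss_law_add R d T P _ _ (dot (M^T *m a) mu)
    (dot (N^T *m a) nu + dot a c) (quad S (M^T *m a)) (quad U (N^T *m a))
    (mX (M^T *m a)) (mW a) (quad_ge0 _ Sp) (quad_ge0 _ Up).
  + by congr (P _); apply/funext => t /=; rewrite dE.
  + move=> E mE; rewrite -(addr0 (dot _ mu)) -(normal_vector_form xN)//.
    by under [in RHS]eq_fun do rewrite addr0.
  + by move=> E mE; exact: (normal_vector_form wN).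
  + move=> E F mE mF.
    have := ind _ _ (borel_dot (M^T *m a) 0 mE) (borel_dot (N^T *m a) (dot a c) mF).
    rewrite (_ : [set y | E _] = [set y | E (dot (M^T *m a) y)])//.
    by apply/seteqP; split => y /=; rewrite addr0.
Qed.

(** After standardisation the event contains the half-line up to [Phi_inv (1 - p)], of mass [1 - p].
    The constant [c] allows an input constraint to be read as a constraint on the state. *)
Lemma chance_constraint n (x : T -> 'cV[R]_n) mu S U (a : 'cV[R]_n) (c b p : R) :
  normal_vector P x mu S -> loewner_le S U -> 0 < p <= 2^-1 ->
  dot a mu + c <= b - Num.sqrt (quad U a) * Phi_inv (1 - p) ->
  ((1 - p)%:E <= P [set t | (dot a (x t) + c <= b)%R])%E.
Proof.
move=> xN SU /andP[p0 p2] le_b.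
have [|z0 Phiz] := @Phi_invP R (1 - p).
  by apply/andP; split; lra.
have [Sp _ _] := xN.
have -> : [set t | dot a (x t) + c <= b] = (fun t => dot a (x t) + c) @^-1` `]-oo, b].
  by apply/seteqP; split => t; rewrite /= in_itv.
rewrite (normal_vector_form xN)// gauss_affine ?quad_ge0//.
rewrite -{1}Phiz PhiE; apply: le_measure; rewrite ?inE//.
  by rewrite -[X in measurable X]setTI; exact: measurable_affine.
move=> y /=; rewrite !in_itv/= => yz.
rewrite -lerBrDr; apply: (@le_trans _ _ (Num.sqrt (quad S a) * Phi_inv (1 - p))).
  by rewrite ler_wpM2l ?sqrtr_ge0.
rewrite lerBrDr -lerBrDl; apply: le_trans le_b _.
(* Replacing [S] by the larger [U] goes in the right direction because the quantile is
   nonnegative. *)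
rewrite lerD2l lerN2 ler_wpM2r// ler_wsqrtr//.
by rewrite -subr_ge0 -quadB; case: SU => _; exact.
Qed.

End NormalVectors.

(** * Matrix-valued expectations *)

Section ExpectMx.
Context {R : realType} {d : measure_display} {T : measurableType d}.
Variable P : probability T R.

Lemma expect_mx_affine m n (M : 'M[R]_(m, n)) (v : 'cV[R]_m)
    (x : T -> 'cV[R]_n) mu S : normal_vector P x mu S ->
  expect_mx P (fun t => M *m (x t - mu) + v) = v.
Proof.
move=> xN; apply/matrixP => i j; rewrite mxE (ord1 j).
rewrite (_ : (fun t => _) = fun t => dot (M^T *m delta_mx i 0) (x t - mu) + v i 0).
  by rewrite (normal_vector_mean_affine xN).
by apply/funext => t; rewrite -dot_mulmx dot_delta [LHS]mxE.
Qed.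

(** Entry [(i, j)] is the covariance of the linear forms given by row [i] of [M] and row [j] of
    [N]. *)
Lemma expect_mx_cross m n k (M : 'M[R]_(m, n)) (N : 'M[R]_(k, n))
    (x : T -> 'cV[R]_n) mu S : normal_vector P x mu S ->
  expect_mx P (fun t => M *m (x t - mu) *m (N *m (x t - mu))^T) = M *m S *m N^T.
Proof.
move=> xN; apply/matrixP => i j; rewrite mxE.
rewrite (_ : (fun t => _) = fun t =>
    dot (M^T *m delta_mx i 0) (x t - mu) * dot (N^T *m delta_mx j 0) (x t - mu)).
  rewrite (normal_vector_cov xN) /= trmx_mul trmxK trmx_delta !mulmxA.
  by rewrite -!mulmxA -rowE !mulmxA -colE !mxE.
apply/funext => t; rewrite -!dot_mulmx !dot_delta [LHS]mxE big_ord1.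
by rewrite [X in _ * X = _]mxE.
Qed.

End ExpectMx.

(** * Linear matrix inequalities and convexity *)

Section ConvexCombinations.
Context {R : realType}.

Lemma quadN n (Q : 'M[R]_n) a : quad Q (- a) = quad Q a.
Proof.
have tN : (- a)^T = - a^T by rewrite linearN.
by rewrite /quad tN !mulNmx mulmxN opprK.
Qed.

(** Jensen's inequality: the gap between the two sides is the weighted sum of [quad Q] at the
    deviations from the barycentre [h]. *)
Lemma quad_convex n N (Q : 'M[R]_n) (lam : 'I_N -> R) (g : 'I_N -> 'cV[R]_n) :
  psd Q -> (forall l, 0 <= lam l) -> \sum_l lam l = 1 ->
  quad Q (\sum_l lam l *: g l) <= \sum_l lam l * quad Q (g l).
Proof.
move=> [Qsym Q0] lam0 lam1; set h := \sum_l _.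
have : 0 <= \sum_l lam l * quad Q (g l - h).
  by apply: sumr_ge0 => l _; rewrite mulr_ge0.
have -> : \sum_l lam l * quad Q (g l - h) =
    \sum_l (lam l * quad Q (g l) + - 2 * (lam l * ((g l)^T *m Q *m h) 0 0)
      + lam l * quad Q h).
  apply: eq_bigr => l _; rewrite quadDr// mulmxN quadN.
  by rewrite [X in 2 * X]mxE; ring.
rewrite !big_split/= -mulr_sumr -mulr_suml lam1 mul1r.
have -> : \sum_l lam l * ((g l)^T *m Q *m h) 0 0 = quad Q h.
  have hT : h^T = \sum_l lam l *: (g l)^T.
    by rewrite linear_sum; apply: eq_bigr => l _; rewrite linearZ.
  rewrite /quad hT !mulmx_suml summxE; apply: eq_bigr => l _.
  by rewrite -!scalemxAl [RHS]mxE.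
by move=> h0; lra.
Qed.

Lemma polyhedron_convex n N M (a : 'I_N -> 'cV[R]_n) b (lam : 'I_M -> R) z :
  (forall l, 0 <= lam l) -> \sum_l lam l = 1 ->
  (forall l, polyhedron a b (z l)) -> polyhedron a b (\sum_l lam l *: z l).
Proof.
move=> lam0 lam1 zP i _ /=.
have -> : dot (a i) (\sum_l lam l *: z l) = \sum_l lam l * dot (a i) (z l).
  rewrite /dot mulmx_sumr summxE; apply: eq_bigr => l _.
  by rewrite -scalemxAr mxE.
rewrite -[leRHS]mul1r -lam1 mulr_suml; apply: ler_sum => l _.
by rewrite ler_wpM2l//; exact: zP.
Qed.

(** The quadratic form vanishes on the left kernel, which is therefore trivial. *)
Lemma posdef_unitmx n (S : 'M[R]_n) : posdef S -> S \in unitmx.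
Proof.
move=> [_ S0]; rewrite -row_free_unit -kermx_eq0; apply/rowV0P => u /sub_kermxP uS.
apply/eqP; apply: contraT => u0; have := S0 u^T.
by rewrite trmx_eq0 u0 /quad trmxK uS mul0mx mxE ltxx => /(_ isT).
Qed.

Lemma posdef_psd n (S : 'M[R]_n) : posdef S -> psd S.
Proof.
move=> [Ssym S0]; split=> // a; have [->|/S0/ltW//] := eqVneq a 0.
by rewrite /quad mulmx0 mxE.
Qed.

Lemma psd1 n : psd (1%:M : 'M[R]_n).
Proof.
split=> [|a]; first by rewrite trmx1.
rewrite /quad mulmx1 mxE; apply: sumr_ge0 => i _.
by rewrite mxE -expr2 sqr_ge0.
Qed.

End ConvexCombinations.

(** * The semidefinite program and the invariant set *)

Section Synthesis.
Context {R : realType} {nx nu nw Np : nat}.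
Variables (A : 'I_Np -> 'M[R]_nx) (B : 'I_Np -> 'M[R]_(nx, nu)).
Variables (D : 'I_Np -> 'M[R]_(nx, nw)) (r : 'I_Np -> 'cV[R]_nx).

(** The point is that the same weights serve all four blocks. *)
Lemma admissibleP A0 B0 D0 r0 : admissible A B D r A0 B0 D0 r0 ->
  exists lam : 'I_Np -> R, [/\ forall l, 0 <= lam l, \sum_l lam l = 1 &
    [/\ A0 = \sum_l lam l *: A l, B0 = \sum_l lam l *: B l,
        D0 = \sum_l lam l *: D l & r0 = \sum_l lam l *: r l]].
Proof.
case=> lam [lam0 lam1 E]; exists lam; split=> //.
have EA := congr1 lsubmx E; have E1 := congr1 rsubmx E.
have EB := congr1 lsubmx E1; have E2 := congr1 rsubmx E1.
have ED := congr1 lsubmx E2; have Er := congr1 rsubmx E2.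
move: EA EB ED Er.
rewrite /sys_mx !row_mxKr !row_mxKl !linear_sum/= => -> -> -> ->.
by split; apply: eq_bigr => l _; rewrite !linearZ/= ?row_mxKr ?row_mxKl.
Qed.

(** This is the Schur complement of the lower right block: for fixed [a], the vector [- g] minimises
    the block quadratic form over the second component. *)
Lemma schur_quad (Sf : 'M[R]_nx) (Z : 'M[R]_(nu, nx)) (l : 'I_Np) (a : 'cV[R]_nx) :
  posdef Sf -> sdp_feasible A B D Sf Z ->
  quad Sf ((A l + B l *m (Z *m invmx Sf))^T *m a) + quad 1%:M ((D l)^T *m a)
    <= quad Sf a.
Proof.
move=> Spd /(_ l) [_].
set G := A l + B l *m _; set g := G^T *m a => /(_ (col_mx a (- g))).
have GS : A l *m Sf + B l *m Z = G *m Sf.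
  by rewrite /G mulmxDl -!mulmxA mulVmx ?posdef_unitmx// mulmx1.
have Ssym : Sf^T = Sf by case: Spd.
have GST : Sf *m (A l)^T + Z^T *m (B l)^T = Sf *m G^T.
  by rewrite -{2}Ssym -(trmx_mul G) -GS linearD /= !trmx_mul Ssym.
rewrite GS GST /quad tr_col_mx mul_row_block mul_row_col.
have tN : (- g)^T = - g^T by rewrite linearN.
have gT : g^T = a^T *m G by rewrite /g trmx_mul trmxK.
have -> : (a^T *m (Sf - D l *m (D l)^T) + (- g)^T *m (Sf *m G^T)) *m a +
    (a^T *m (G *m Sf) + (- g)^T *m Sf) *m (- g) =
    a^T *m (Sf - D l *m (D l)^T) *m a - g^T *m Sf *m g.
  (* Since [a^T *m G = g^T], the factor in front of the last [- g] is zero. *)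
  rewrite tN mulmxDl !mulNmx -!mulmxA -/g [a^T *m (G *m Sf)]mulmxA -gT.
  by rewrite subrr mul0mx addr0.
have -> : (a^T *m (Sf - D l *m (D l)^T) *m a - g^T *m Sf *m g) 0 0 =
    quad (Sf - D l *m (D l)^T) a - quad Sf g.
  by rewrite [LHS]mxE [X in _ + X]mxE.
rewrite quadB -{1}[D l]mulmx1 quad_congr.
by rewrite -!/(quad _ _) => h; lra.
Qed.

(** Both arguments of the quadratic forms are convex combinations of their vertex values with common
    weights, so Jensen's inequality reduces the bound to [schur_quad]. *)
Lemma admissible_quad Sf Z A0 B0 D0 r0 (a : 'cV[R]_nx) :
  posdef Sf -> sdp_feasible A B D Sf Z -> admissible A B D r A0 B0 D0 r0 ->
  quad Sf ((A0 + B0 *m (Z *m invmx Sf))^T *m a) + quad 1%:M (D0^T *m a)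
    <= quad Sf a.
Proof.
move=> Spd fs /admissibleP[lam [lam0 lam1 [-> -> -> _]]].
set L := Z *m _.
have -> : (\sum_l lam l *: A l + (\sum_l lam l *: B l) *m L)^T *m a =
    \sum_l lam l *: ((A l + B l *m L)^T *m a).
  rewrite mulmx_suml -big_split/= linear_sum mulmx_suml; apply: eq_bigr => l _.
  by rewrite -scalemxAl -scalerDr linearZ/= -scalemxAl.
have -> : (\sum_l lam l *: D l)^T *m a = \sum_l lam l *: ((D l)^T *m a).
  rewrite linear_sum mulmx_suml; apply: eq_bigr => l _.
  by rewrite linearZ/= -scalemxAl.
apply: (le_trans (lerD (quad_convex _ (posdef_psd Spd) lam0 lam1)
  (quad_convex _ (psd1 nw) lam0 lam1))).
rewrite -big_split/=.
have -> : quad Sf a = \sum_l lam l * quad Sf a by rewrite -mulr_suml lam1 mul1r.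
by apply: ler_sum => l _; rewrite -mulrDr ler_wpM2l//; exact: schur_quad.
Qed.

(** With [G = A0 + B0 *m L] the five terms regroup as [G *m S *m G^T + D0 *m D0^T]; then [S] is
    bounded by [Sf] at the vector [G^T *m a]. *)
Lemma closed_loop_covariance_le Sf Z S A0 B0 D0 r0 :
  posdef Sf -> sdp_feasible A B D Sf Z -> psd S -> loewner_le S Sf ->
  admissible A B D r A0 B0 D0 r0 ->
  let L := Z *m invmx Sf in
  loewner_le (A0 *m S *m A0^T + A0 *m (S *m L^T) *m B0^T
    + B0 *m (S *m L^T)^T *m A0^T + B0 *m (L *m S *m L^T) *m B0^T + D0 *m D0^T) Sf.
Proof.
move=> Spd fs Sp [_ SSf] adm L.
have Ssym : S^T = S by case: Sp.
have Sfsym : Sf^T = Sf by case: Spd.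
set G := A0 + B0 *m L.
have -> : A0 *m S *m A0^T + A0 *m (S *m L^T) *m B0^T
    + B0 *m (S *m L^T)^T *m A0^T + B0 *m (L *m S *m L^T) *m B0^T + D0 *m D0^T =
    G *m S *m G^T + D0 *m 1%:M *m D0^T.
  have GT : G^T = A0^T + L^T *m B0^T by rewrite linearD /= (trmx_mul B0 L).
  rewrite mulmx1 GT /G !mulmxDl !mulmxDr (trmx_mul S) trmxK Ssym !mulmxA.
  by rewrite -!addrA.
split=> [|a].
  have [s1 _] := psd_congr G Sp; have [s2 _] := psd_congr D0 (psd1 (R := R) nw).
  by rewrite linearB /= linearD /= s1 s2 Sfsym.
rewrite quadB quadD !quad_congr subr_ge0.
apply: le_trans (admissible_quad a Spd fs adm); rewrite lerD2r.
by rewrite -subr_ge0 -quadB.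
Qed.

Lemma largest_invariant_convex N M (ax : 'I_N -> 'cV[R]_nx) bx
    (au : 'I_M -> 'cV[R]_nu) bu X :
  is_largest (safe_invariant A B r (polyhedron ax bx) (polyhedron au bu)) X ->
  forall K (lam : 'I_K -> R) z, (forall k, 0 <= lam k) -> \sum_k lam k = 1 ->
  (forall k, X (z k)) -> X (\sum_k lam k *: z k).
Proof.
move=> [[Xsafe Xinv] Xmax] K lam z lam0 lam1 zX.
(* The convex hull of [X], to be shown safe and invariant so that maximality gives [Y] inside
   [X]. *)
pose Y : set 'cV[R]_nx := [set y | exists K (lam : 'I_K -> R) (z : 'I_K -> 'cV[R]_nx),
  [/\ forall k, 0 <= lam k, \sum_k lam k = 1, forall k, X (z k) &
      y = \sum_k lam k *: z k]].
apply: (Xmax Y); last by exists K, lam, z.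
split=> [_ [K' [la [y [la0 la1 yX ->]]]]|_ [K' [la [y [la0 la1 yX ->]]]]].
  by apply: polyhedron_convex => // k; exact: Xsafe.
have /choice[v vP] : forall k, exists v, polyhedron au bu v /\
    forall l, X (A l *m y k + B l *m v + r l).
  by move=> k; have [v Uv Xv] := Xinv _ (yX k); exists v.
(* The inputs are mixed with the weights of the points; the affine dynamics then mix the successors
   in the same way at every vertex. *)
exists (\sum_k la k *: v k).
  by apply: polyhedron_convex => // k; case: (vP k).
move=> l; exists K', la, (fun k => A l *m y k + B l *m v k + r l); split=> //.
  by move=> k; case: (vP k).
under [RHS]eq_bigr do rewrite !scalerDr.
(* The weights sum to one, so the offset [r l] is reproduced exactly. *)
rewrite !big_split/= -scaler_suml la1 scale1r !mulmx_sumr.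
by congr (_ + _ + _); apply: eq_bigr => k _; rewrite scalemxAr.
Qed.

End Synthesis.

Theorem theorem2 (R : realType) (nx nu nw Np Nx Nu : nat)
  (A : 'I_Np -> 'M[R]_nx) (B : 'I_Np -> 'M[R]_(nx, nu))
  (D : 'I_Np -> 'M[R]_(nx, nw)) (r : 'I_Np -> 'cV[R]_nx)
  (alphax : 'I_Nx -> 'cV[R]_nx) (betax px : 'I_Nx -> R)
  (alphau : 'I_Nu -> 'cV[R]_nu) (betau pu : 'I_Nu -> R)
  (hpx : forall i, 0 < px i <= 2^-1) (hpu : forall j, 0 < pu j <= 2^-1)
  (Sf : 'M[R]_nx) (Z : 'M[R]_(nu, nx))
  (hopt : sdp_optimal A B D Sf Z) (hSf : posdef Sf)
  (Xf : set 'cV[R]_nx)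
  (hXf : let L := Z *m invmx Sf in
    let Xsafe := polyhedron alphax (tighten alphax betax px Sf) in
    let Usafe := polyhedron alphau
                   (tighten alphau betau pu (L *m Sf *m L^T)) in
    is_largest (safe_invariant A B r Xsafe Usafe) Xf)
  (mu : 'cV[R]_nx) (hmu : Xf mu)
  (S : 'M[R]_nx) (hS : psd S) (hSSf : loewner_le S Sf) :
  exists rho : 'cV[R]_nx -> 'cV[R]_nu,
    is_policy A B D r mu S rho /\
    forall (A0 : 'M[R]_nx) (B0 : 'M[R]_(nx, nu)) (D0 : 'M[R]_(nx, nw))
      (r0 : 'cV[R]_nx), admissible A B D r A0 B0 D0 r0 ->
    forall (d : measure_display) (T : measurableType d) (P : probability T R)
      (x : T -> 'cV[R]_nx), normal_vector P x mu S ->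
    let u := fun t => rho (x t) in
    let ubar := expect_mx P u in
    let Sxu := expect_mx P (fun t => (x t - mu) *m (u t - ubar)^T) in
    let Su := expect_mx P (fun t => (u t - ubar) *m (u t - ubar)^T) in
    square_integrable P u /\
    (forall i, ((1 - px i)%:E <= P [set t | (dot (alphax i) (x t) <= betax i)%R])%E) /\
    (forall j, ((1 - pu j)%:E <= P [set t | (dot (alphau j) (u t) <= betau j)%R])%E) /\
    Xf (A0 *m mu + B0 *m ubar + r0) /\
    loewner_le (A0 *m S *m A0^T + A0 *m Sxu *m B0^T + B0 *m Sxu^T *m A0^T
                + B0 *m Su *m B0^T + D0 *m D0^T) Sf.
Proof.
rewrite /= in hXf; set L := Z *m invmx Sf in hXf *.
have [[Xsub Xinv] _] := hXf.
have [v Uv Xv] := Xinv _ hmu.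
have [fs _] := hopt.
(* Constant term of the feedback centred at [mu]; with it the mean input is [v]. *)
pose c := v - L *m mu.
exists (fun y => L *m y + c).
have rhoE (y : 'cV[R]_nx) : L *m y + c = L *m (y - mu) + v.
  by rewrite /c mulmxBr addrA addrAC.
split.
  split; first exact: borel_fun_affine.
  move=> A0 B0 D0 r0 _ d T P x w xN wN ind.
  (* The next state regrouped as closed-loop matrix times [x], plus noise, plus a constant. *)
  have nN := normal_vector_affine_add (A0 + B0 *m L) D0 (B0 *m c + r0) xN wN ind.
  exists (((A0 + B0 *m L) *m mu) + D0 *m 0 + (B0 *m c + r0)); eexists.
  move: nN; congr (normal_vector _ _ _ _); apply/funext => t.
  rewrite mulmxDl (mulmxDr B0) (mulmxA B0) !addrA; congr (_ + r0).
  by rewrite [LHS]addrAC.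
move=> A0 B0 D0 r0 adm d T P x xN u ubar Sxu Su.
have uE t : u t = L *m (x t - mu) + v by exact: rhoE.
have ubarE : ubar = v.
  rewrite /ubar (_ : u = fun t => L *m (x t - mu) + v); last exact/funext.
  exact: (expect_mx_affine L v xN).
have uc t : u t - ubar = L *m (x t - mu) by rewrite uE ubarE addrK.
have SxuE : Sxu = S *m L^T.
  have := expect_mx_cross 1%:M L xN; rewrite mul1mx => <-.
  by congr expect_mx; apply/funext => t; rewrite uc mul1mx.
have SuE : Su = L *m S *m L^T.
  rewrite -(expect_mx_cross L L xN).
  by congr expect_mx; apply/funext => t; rewrite uc.
split.
  move=> i; rewrite (_ : (fun t => _) =
      fun t => dot (L^T *m delta_mx i 0) (x t - mu) + v i 0).
    exact: (normal_vector_Lfun2 xN).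
  by apply/funext => t; rewrite uE -dot_mulmx dot_delta [LHS]mxE.
split.
  move=> i; have := Xsub _ hmu i I; rewrite /= /tighten => le_b.
  have := @chance_constraint _ _ _ P _ x mu S Sf (alphax i) 0 (betax i) (px i)
    xN hSSf (hpx i).
  rewrite addr0 => /(_ le_b).
  by under eq_set do rewrite addr0.
split.
  move=> j; have := Uv j I; rewrite /= /tighten quad_congr => le_b.
  (* The input constraint is one on the form [L^T *m alphau j] of the state, whose variance under
     [Sf] is the one in the tightened bound. *)
  have := @chance_constraint _ _ _ P _ x mu S Sf (L^T *m alphau j)
    (dot (alphau j) c) (betau j) (pu j) xN hSSf (hpu j).
  rewrite -dot_mulmx -dotDr rhoE subrr mulmx0 add0r => /(_ le_b).
  by under eq_set do rewrite -dot_mulmx -dotDr.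
split; last by rewrite SxuE SuE; exact: (closed_loop_covariance_le hSf fs hS hSSf adm).
have [lam [lam0 lam1 [-> -> _ ->]]] := admissibleP adm.
(* One input [v] serves all vertices, so the next mean is the convex combination of the vertex
   successors, each of which lies in [Xf]. *)
have -> : (\sum_l lam l *: A l) *m mu + (\sum_l lam l *: B l) *m ubar + \sum_l lam l *: r l
    = \sum_l lam l *: (A l *m mu + B l *m v + r l).
  under [RHS]eq_bigr do rewrite !scalerDr.
  rewrite !big_split/= ubarE !mulmx_suml.
  by congr (_ + _ + _); apply: eq_bigr => l _; rewrite scalemxAl.
exact: (largest_invariant_convex hXf).
Qed.
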